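(* Let $0\leq \gamma<1$. Then the following inequalities hold for all $x>0$: \[ \int_0^x t^{\nu}I_{\nu}(t)\,\mathrm{d}t > x^{\nu}I_{\nu+1}(x), \quad \nu>-1; \] \[ \int_0^x t^{\nu}I_{\nu}(t)\,\mathrm{d}t < x^{\nu}I_{\nu}(x), \quad \nu\geq 1/2; \] \[ I_{(\nu,0,n+1)}(x) < I_{(\nu,0,n)}(x), \quad \nu\geq 1/2,\ n=0,1,2,\ldots; \] \[ I_{(\nu,-\gamma,n)}(x) \leq \frac{1}{(1-\gamma)^n}\,\mathrm{e}^{-\gamma x}I_{(\nu,0,n)}(x), \quad \nu\geq 1/2,\ n=0,1,2,\ldots; \] \[ \int_0^x t^{\nu}I_{\nu+n}(t)\,\mathrm{d}t < \frac{2(\nu+n+1)}{2\nu+n+1}\,x^{\nu}I_{\nu+n+1}(x), \quad \nu>-1/2,\ n\geq 0 \ (n \text{ real}); \] \[ I_{(\nu,0,n)}(x) < \left\{\prod_{k=1}^n \frac{2\nu+2k}{2\nu+k}\right\} x^{\nu}I_{\nu+n}(x), \quad \nu\geq 0,\ n=1,2,3,\ldots; \] \[ I_{(\nu,-\gamma,n)}(x) < \frac{1}{(1-\gamma)^n}\left\{\prod_{k=1}^n \frac{2\nu+2k}{2\nu+k}\right\} \mathrm{e}^{-\gamma x}x^{\nu}I_{\nu+n}(x), \quad \nu\geq 1/2,\ n=1,2,3,\ldots. \]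
   Context: All parameters and variables ($\nu$, $\gamma$, $\beta$, $x$) are real. $I_{\nu}(x)$ denotes the modified Bessel function of the first kind, $I_\nu(x)=\sum_{k=0}^\infty \frac{(x/2)^{\nu+2k}}{k!\,\Gamma(\nu+k+1)}$ for $x>0$. For $\beta\in\mathbb{R}$, the repeated integrals of $\mathrm{e}^{\beta x}x^{\nu}I_{\nu}(x)$ are defined by \[ I_{(\nu,\beta,0)}(x)=\mathrm{e}^{\beta x}x^{\nu}I_{\nu}(x),\qquad I_{(\nu,\beta,n+1)}(x)=\int_0^x I_{(\nu,\beta,n)}(y)\,\mathrm{d}y,\quad n=0,1,2,3,\ldots. \] Integrals of positive functions are understood as values in $(0,+\infty]$; in particular in the first inequality, for $-1<\nu\le -1/2$, the integral on the left diverges to $+\infty$ and the inequality holds in that sense. *)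

(* Defs.v *)
From HB Require Import structures.
From mathcomp Require Import all_boot all_order all_algebra.
From mathcomp Require Import all_classical all_reals all_analysis.

Set Implicit Arguments.
Unset Strict Implicit.
Unset Printing Implicit Defensive.

Import Order.TTheory GRing.Theory Num.Theory.
Import numFieldNormedType.Exports.

Local Open Scope classical_set_scope.
Local Open Scope ring_scope.

(* Euler's integral, hence Gamma(z) for z > 0 only. *)
Definition Gamma (R : realType) (z : R) : R :=
  \int[lebesgue_measure]_(t in `]0, +oo[) (t `^ (z - 1) * expR (- t)).

Definition besselI_coef (R : realType) (nu x : R) (k : nat) : R :=
  (x / 2) `^ (nu + 2 * k%:R) / (k`!%:R * Gamma (nu + k%:R + 1)).

(* Meaningful for nu > -1 and x > 0: the arguments of Gamma are then positive. *)
Definition besselI (R : realType) (nu x : R) : R :=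
  limn (series (besselI_coef nu x)).

(* Lebesgue integral over the open interval ]0, x[ (the integrands only make
   sense for t > 0), with values in \bar R so that the divergent integral of a
   nonnegative function is +oo. *)
Definition int0 (R : realType) (f : R -> \bar R) (x : R) : \bar R :=
  (\int[lebesgue_measure]_(t in `]0%R, x[) f t)%E.

Fixpoint repeatedI (R : realType) (nu beta : R) (n : nat) : R -> \bar R :=
  match n with
  | 0 => fun x => (expR (beta * x) * x `^ nu * besselI nu x)%:E
  | n'.+1 => int0 (repeatedI nu beta n')
  end.

(* Main.v *)
Require Import Defs.
From mathcomp Require Import all_boot all_order all_algebra.
From mathcomp Require Import all_classical all_reals all_analysis.
From mathcomp Require Import measurable_realfun.
From mathcomp Require Import ring lra.

(** The function [I_m] is a power series with positive coefficients, so
    [t^nu I_m (t)] may be integrated termwise, and the inequalities with a single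
    integral that compare Bessel functions of order [m] and [m + 1] reduce to
    comparing coefficients ([powR_besselI_lt_int0], [int0_lt_powR_besselI]).

    The bound of the integral of [F = x^nu I_nu] by [F] itself compares even and
    odd powers and is not termwise. It follows from two termwise facts: [F] is
    the integral of [G = x^nu I_(nu-1)] ([int0_powR_besselIB1]), and the integral
    [P] of [F] satisfies [P < G] when [nu >= 1/2] ([int0_lt_powR_besselIB1]).
    Indeed [e^x (F - P)] then has the positive derivative [e^x (G - P)] and
    vanishes at 0 ([int0_lt_powR_besselI_same]).

    The repeated integrals are treated by induction. Strict inequalities
    integrate to strict inequalities as soon as the smaller integral is finite,
    which gives the monotonicity in [n] ([repeatedI_decr]) and the product bound
    ([repeatedI_lt]). For the exponential weight, integration by parts and the
    monotonicity in [n] yield the factor [1 / (1 - gamma)] at each step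
    ([int0_expRN_repeatedI]).

    Everything is nonnegative, so the integrals live in the extended reals and
    integration by parts is replaced throughout by the Tonelli theorem on a
    triangle ([ge0_integral_triangle]), which avoids differentiating Bessel
    functions. The same device gives [Gamma (z + 1) = z * Gamma z] from the
    definition of [Gamma] by Euler's integral. *)

Import Order.TTheory GRing.Theory Num.Theory.
Import numFieldNormedType.Exports.

Local Open Scope classical_set_scope.
Local Open Scope ring_scope.

Set Implicit Arguments.
Unset Strict Implicit.
Unset Printing Implicit Defensive.

(** * Tonelli's theorem on a triangle *)

Section Triangle.
Variable R : realType.
Implicit Types (f g : R -> \bar R) (D : set R).
Local Notation mu := (@lebesgue_measure R).
Local Open Scope ereal_scope.

(** [f (t) g (s)] cut down to the triangle [t < s] of the square [D x D]; the
    factors are extended by 0 so that the Tonelli theorem can be applied on the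
    whole plane. *)
Definition triangle_kernel D f g (p : R * R) : \bar R :=
  (f \_ D) p.1 * (g \_ D) p.2 * (\1_[set q : R * R | (q.1 < q.2)%R] p)%:E.

Lemma measurable_triangle_kernel D f g : measurable D ->
  measurable_fun D f -> measurable_fun D g ->
  measurable_fun setT (triangle_kernel D f g).
Proof.
move=> mD mf mg; apply: emeasurable_funM.
  by apply: emeasurable_funM; apply: measurableT_comp => //;
    apply/(measurable_restrictT _ mD).
apply/measurable_EFinP/measurable_indic.
rewrite -[X in measurable X]setTI.
by apply: (measurable_lte measurableT (f := fun q : R * R => q.1%:E)
  (g := fun q : R * R => q.2%:E)); apply/measurable_EFinP.
Qed.

Lemma triangle_kernelEl D f g (t s : R) :
  triangle_kernel D f g (t, s) =
  (f \_ D) t * (g \_ (D `&` [set` `]t, +oo[])) s.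
Proof.
rewrite /triangle_kernel/= -muleA; congr (_ * _).
have -> : (g \_ (D `&` [set` `]t, +oo[])) s =
    if (s \in D) && (t < s)%R then g s else 0.
  by rewrite patchE in_setI; congr (if _ && _ then _ else _); apply/idP/idP;
    rewrite inE/= in_itv/= andbT.
rewrite patchE indicE.
rewrite (_ : ((t, s) \in _) = (t < s)%R); last by apply/idP/idP; rewrite inE.
by case: (s \in D); case: (t < s)%R; rewrite ?mule1 ?mule0.
Qed.

Lemma triangle_kernelEr D f g (t s : R) :
  triangle_kernel D f g (t, s) =
  (g \_ D) s * (f \_ (D `&` [set` `]-oo, s[])) t.
Proof.
rewrite /triangle_kernel/= [_ t * _]muleC -muleA; congr (_ * _).
have -> : (f \_ (D `&` [set` `]-oo, s[])) t =
    if (t \in D) && (t < s)%R then f t else 0.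
  by rewrite patchE in_setI; congr (if _ && _ then _ else _); apply/idP/idP;
    rewrite inE/= in_itv/=.
rewrite patchE indicE.
rewrite (_ : ((t, s) \in _) = (t < s)%R); last by apply/idP/idP; rewrite inE.
by case: (t \in D); case: (t < s)%R; rewrite ?mule1 ?mule0.
Qed.

Lemma triangle_kernel_ge0 D f g p :
  (forall t, D t -> 0 <= f t) -> (forall t, D t -> 0 <= g t) ->
  0 <= triangle_kernel D f g p.
Proof.
move=> f0 g0; apply: mule_ge0; last by rewrite lee_fin.
by apply: mule_ge0; apply: erestrict_ge0.
Qed.

(** The one tool that replaces integration by parts: writing a weight as the
    integral of its derivative and exchanging the integrals over the triangle
    [t < s] moves the derivative onto the weight, with no regularity required of
    [f] beyond measurability. *)
Lemma ge0_integral_triangle D f g : measurable D ->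
  measurable_fun D f -> measurable_fun D g ->
  (forall t, D t -> 0 <= f t) -> (forall t, D t -> 0 <= g t) ->
  \int[mu]_(t in D) (f t * \int[mu]_(s in D `&` [set` `]t, +oo[]) g s) =
  \int[mu]_(s in D) (g s * \int[mu]_(t in D `&` [set` `]-oo, s[]) f t).
Proof.
move=> mD mf mg f0 g0.
have mDr (a : R) : measurable (D `&` [set` `]a, +oo[]) by exact: measurableI.
have mDl (a : R) : measurable (D `&` [set` `]-oo, a[]) by exact: measurableI.
transitivity (\int[mu]_t \int[mu]_s triangle_kernel D f g (t, s)).
  rewrite [LHS]integral_mkcond; apply: eq_integral => t _.
  under [RHS]eq_integral do rewrite triangle_kernelEl.
  rewrite ge0_integralZl//; first last.
  - by apply: erestrict_ge0.
  - by move=> s _; apply: erestrict_ge0 => {}s [Ds _]; exact: g0.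
  - by apply/(measurable_restrictT _ (mDr t)); apply: measurable_funS mg.
  by rewrite -integral_mkcond !patchE; case: ifP => // _; rewrite mul0e.
rewrite fubini_tonelli; first last.
- by move=> p; exact: triangle_kernel_ge0.
- exact: measurable_triangle_kernel.
rewrite [RHS]integral_mkcond; apply: eq_integral => s _.
under eq_integral do rewrite triangle_kernelEr.
rewrite ge0_integralZl//; first last.
- by apply: erestrict_ge0.
- by move=> t _; apply: erestrict_ge0 => {}t [Dt _]; exact: f0.
- by apply/(measurable_restrictT _ (mDl s)); apply: measurable_funS mf.
by rewrite -integral_mkcond !patchE; case: ifP => // _; rewrite mul0e.
Qed.

(** Needed to iterate indefinite integrals: the indefinite integral is a
    marginal of the triangle kernel, hence measurable. *)
Lemma measurable_integral_lower D f : measurable D -> measurable_fun D f ->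
  (forall t, D t -> 0 <= f t) ->
  measurable_fun D (fun s => \int[mu]_(t in D `&` [set` `]-oo, s[]) f t).
Proof.
move=> mD mf f0.
apply/(measurable_restrictT _ mD).
have mDl (a : R) : measurable (D `&` [set` `]-oo, a[]) by exact: measurableI.
have m1 : measurable_fun D (fun=> 1%E : \bar R) by exact: measurable_cst.
have := measurable_fun_fubini_tonelli_G (m1 := mu) _
  (measurable_triangle_kernel mD mf m1)
  (fun p => triangle_kernel_ge0 p f0 (fun _ _ => lee01)).
apply: eq_measurable_fun => s _.
rewrite /fubini_G.
under eq_integral do rewrite triangle_kernelEr.
rewrite ge0_integralZl//; first last.
- by apply: erestrict_ge0.
- by move=> t _; apply: erestrict_ge0 => {}t [Dt _]; exact: f0.
- by apply/(measurable_restrictT _ (mDl s)); apply: measurable_funS mf.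
by rewrite -integral_mkcond !patchE; case: ifP => // _; rewrite (mul1e,mul0e).
Qed.

End Triangle.

(** * Strict comparison of integrals and series *)

Section Strict.
Variable R : realType.
Implicit Types (f g : R -> \bar R) (D : set R).
Local Notation mu := (@lebesgue_measure R).

Lemma ge0_integral_gt0 D f : measurable D -> measurable_fun D f ->
  (0 < mu D)%E -> (forall t, D t -> 0 < f t)%E ->
  (0 < \int[mu]_(t in D) f t)%E.
Proof.
move=> mD mf D0 f0; rewrite lt0e integral_ge0; last by move=> t /f0/ltW.
rewrite andbT; apply/negP => /eqP If0.
have : (\int[mu]_(t in D) `|f t| = 0)%E.
  rewrite -[RHS]If0; apply: eq_integral => t /set_mem Dt.
  by rewrite gee0_abs// ltW// f0.
move=> /(ae_eq_integral_abs mu mD mf)[N [mN N0 sN]].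
have : (mu D <= mu N)%E.
  apply: le_measure; rewrite ?inE// => t Dt; apply: sN => /= /(_ Dt) /eqP.
  by rewrite gt_eqF// f0.
by rewrite N0 leNgt D0.
Qed.

(** The pointwise strict inequality forces [f] to be finite, so [g - f] makes
    sense, and its integral is positive. *)
Lemma ge0_lt_integral D f g : measurable D -> (0 < mu D)%E ->
  measurable_fun D f -> measurable_fun D g ->
  (forall t, D t -> 0 <= f t)%E -> (forall t, D t -> f t < g t)%E ->
  (\int[mu]_(t in D) f t < +oo)%E ->
  (\int[mu]_(t in D) f t < \int[mu]_(t in D) g t)%E.
Proof.
move=> mD D0 mf mg f0 fg If.
have ffin t : D t -> f t \is a fin_num.
  move=> Dt; rewrite ge0_fin_numE ?f0//.
  exact: lt_le_trans (fg _ Dt) (leey _).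
rewrite [ltRHS](_ : _ =
    \int[mu]_(t in D) f t + \int[mu]_(t in D) (g t - f t))%E.
  rewrite lteDl; last by rewrite ge0_fin_numE// integral_ge0.
  apply: ge0_integral_gt0 => //; first exact: emeasurable_funB.
  by move=> t Dt; rewrite sube_gt0 fg.
rewrite -ge0_integralD//.
- by apply: eq_integral => t /set_mem Dt; rewrite addeC subeK// ffin.
- by move=> t Dt; rewrite sube_ge0 ?ltW ?fg// ffin.
- exact: emeasurable_funB.
Qed.

Lemma lt_nneseries (a b : nat -> R) j : (forall k, 0 <= a k) ->
  (forall k, a k <= b k) -> a j < b j ->
  (\sum_(k <oo) (a k)%:E < +oo)%E ->
  (\sum_(k <oo) (a k)%:E < \sum_(k <oo) (b k)%:E)%E.
Proof.
move=> a0 ab abj afin.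
have d0 k : (0 <= (b k - a k)%:E)%E by rewrite lee_fin subr_ge0.
have -> : (\sum_(k <oo) (b k)%:E =
    \sum_(k <oo) (a k)%:E + \sum_(k <oo) (b k - a k)%:E)%E.
  rewrite -nneseriesD//; last by move=> k _ _; rewrite lee_fin.
  by apply: eq_eseriesr => k _; rewrite -EFinD subrKC.
rewrite lteDl; last first.
  by rewrite ge0_fin_numE// nneseries_ge0// => k _ _; rewrite lee_fin.
rewrite (@nneseriesD1 _ _ j)//.
apply: lt_le_trans (leeDl _ _); first by rewrite lte_fin subr_gt0.
exact: nneseries_ge0.
Qed.

End Strict.

(** * Integrals of real powers near 0 *)

Section Powers.
Variable R : realType.
Implicit Types (p q a b x t : R) (D : set R).
Local Notation mu := (@lebesgue_measure R).

Lemma powRD1 x p : 0 < x -> x `^ (p + 1) = x `^ p * x.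
Proof.
move=> x0; rewrite powRD; last by rewrite (gt_eqF x0) implybT.
by rewrite powRr1// ltW.
Qed.

Lemma continuous_powR p a : 0 < a -> {for a, continuous (@powR R ^~ p)}.
Proof.
move=> a0; apply: differentiable_continuous; apply/derivable1_diffP.
by apply: derivable_powR; rewrite in_itv/= a0.
Qed.

Lemma measurable_powR_EFin p D : measurable D ->
  measurable_fun D (fun t : R => (t `^ p)%:E).
Proof.
by move=> mD; apply/measurable_EFinP; apply: measurable_funTS;
  exact: measurable_powR.
Qed.

Lemma integral_powR_itv q a b : 0 < a -> a < b ->
  (\int[mu]_(t in `[a, b[) (q * t `^ (q - 1))%:E = (b `^ q - a `^ q)%:E)%E.
Proof.
move=> a0 ab.
have pos t : t \in `[a, b] -> 0 < t.
  by rewrite in_itv/= => /andP[at_ _]; exact: lt_le_trans at_.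
rewrite integral_itv_bndo_bndc; last first.
  apply/measurable_EFinP; apply: measurable_funTS.
  by apply: measurable_funM => //; exact: measurable_powR.
rewrite (@continuous_FTC2 _ _ (@powR R ^~ q)) ?EFinB//.
- apply: continuous_in_subspaceT => t /set_mem /pos t0.
  by apply: cvgM; [exact: cvg_cst|exact: continuous_powR].
- split.
  + move=> t; rewrite in_itv/= => /andP[at_ _].
    by apply: derivable_powR; rewrite in_itv/= andbT (lt_trans a0).
  + by apply/cvg_at_right_filter; exact: continuous_powR.
  + by apply/cvg_at_left_filter; apply: continuous_powR; exact: lt_trans ab.
- move=> t; rewrite in_itv/= => /andP[at_ _].
  by rewrite powR_derive1// in_itv/= andbT (lt_trans a0).
Qed.

(** The denominators start at 2 so that no interval of the union is empty. *)
Lemma itv0x_bigcup x : 0 < x ->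
  `]0, x[%classic = \bigcup_n `[x / n.+2%:R, x[%classic.
Proof.
move=> x0; apply/seteqP; split => t /=.
  rewrite in_itv/= => /andP[t0 tx].
  have [N xtN] : exists N : nat, x / t < N%:R.
    by exists (Num.bound (x / t)); apply/archi_boundP/ltW/divr_gt0.
  exists N => //=; rewrite in_itv/= tx andbT ler_pdivrMr// mulrC -ler_pdivrMr//.
  by rewrite (le_trans (ltW xtN))// ler_nat -addn2 leq_addr.
move=> [n _ /=]; rewrite !in_itv/= => /andP[nt ->]; rewrite andbT.
by apply: lt_le_trans nt; rewrite divr_gt0.
Qed.

(** For [q < 1] the integrand blows up at 0, so the fundamental theorem is used
    away from 0 and the lower bound is sent to 0 by monotone convergence. *)
Lemma integral_powR0 q x : 0 < q -> 0 < x ->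
  (\int[mu]_(t in `]0%R, x[) (q * t `^ (q - 1))%:E = (x `^ q)%:E)%E.
Proof.
move=> q0 x0; rewrite itv0x_bigcup//.
have xn n : 0 < x / n.+2%:R by rewrite divr_gt0.
have lim1 : (\int[mu]_(t in `[(x / n.+2%:R)%R, x[) (q * t `^ (q - 1))%:E)%E
    @[n --> \oo] --> (\int[mu]_(t in \bigcup_n `[(x / n.+2%:R)%R, x[%classic)
      (q * t `^ (q - 1))%:E)%E.
  apply: ge0_nondecreasing_set_cvg_integral => //.
  - apply/nondecreasing_seqP => n; apply/subsetPset => t /=.
    rewrite !in_itv/= => /andP[nt ->]; rewrite andbT.
    by apply: le_trans nt; rewrite ler_pM2l// lef_pV2 ?posrE// ler_nat.
  - move=> n; apply/measurable_EFinP; apply: measurable_funTS.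
    by apply: measurable_funM => //; exact: measurable_powR.
  - by move=> n t _; rewrite lee_fin mulr_ge0 ?powR_ge0// ltW.
have lim2 : (\int[mu]_(t in `[(x / n.+2%:R)%R, x[) (q * t `^ (q - 1))%:E)%E
    @[n --> \oo] --> (x `^ q)%:E.
  under eq_fun => n.
    rewrite integral_powR_itv//; last first.
      by rewrite ltr_pdivrMr// ltr_pMr// ltr1n.
    over.
  apply: cvg_EFin; first by near=> n.
  rewrite -[X in _ --> X]subr0; apply: cvgB; first exact: cvg_cst.
  have /cvg_at_rightP := powR_cvg0 q0; apply; split => //.
  rewrite -(mulr0 x); apply: cvgM; first exact: cvg_cst.
  by have := @cvg_harmonic R; rewrite -cvg_shiftS.
by rewrite (cvg_unique _ lim1 lim2).
Unshelve. all: by end_near. Qed.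

(** On [(0, x)], [t `^ p] dominates [x `^ (p + 1 - q) * t `^ (q - 1)] for every
    [q > 0], and the integral of the latter, [x `^ (p + 1) / q], is unbounded as
    [q] tends to 0. *)
Lemma integral_powR_pinfty p x : p <= -1 -> 0 < x ->
  (\int[mu]_(t in `]0%R, x[) (t `^ p)%:E)%E = +oo%E.
Proof.
move=> p1 x0.
have lb q : 0 < q ->
    ((x `^ (p + 1) / q)%:E <= \int[mu]_(t in `]0%R, x[) (t `^ p)%:E)%E.
  move=> q0; have xq : 0 <= x `^ (p + 1 - q) / q.
    by rewrite divr_ge0 ?powR_ge0// ltW.
  rewrite [leLHS](_ : _ = \int[mu]_(t in `]0%R, x[)
      ((x `^ (p + 1 - q) / q)%:E * (q * t `^ (q - 1))%:E))%E; last first.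
    rewrite ge0_integralZl//; last 2 first.
    - apply/measurable_EFinP/measurable_funTS.
      by apply: measurable_funM => //; exact: measurable_powR.
    - by move=> t _; rewrite lee_fin mulr_ge0 ?powR_ge0// ltW.
    rewrite integral_powR0// -EFinM mulrAC -powRD ?subrK//.
    by rewrite (gt_eqF x0) implybT.
  apply: ge0_le_integral => //.
  - by move=> t _; rewrite -EFinM lee_fin !mulr_ge0 ?powR_ge0 ?invr_ge0// ltW.
  - apply: measurable_funeM; apply/measurable_EFinP/measurable_funTS.
    by apply: measurable_funM => //; exact: measurable_powR.
  - exact: measurable_powR_EFin.
  move=> t /=; rewrite in_itv/= => /andP[t0 tx].
  rewrite -EFinM lee_fin mulrA divfK ?gt_eqF//.
  rewrite (_ : t `^ p = t `^ (p + 1 - q) * t `^ (q - 1)); last first.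
    rewrite -powRD ?(gt_eqF t0) ?implybT//; congr (_ `^ _); ring.
  rewrite ler_wpM2r ?powR_ge0//.
  have -> : p + 1 - q = - (q - p - 1) by ring.
  rewrite !powRN lef_pV2 ?posrE ?powR_gt0//.
  by apply: ge0_ler_powR; rewrite ?nnegrE ?ltW//; lra.
have x1 : 0 < x `^ (p + 1) by rewrite powR_gt0.
case E : (\int[mu]_(t in _) _)%E => [r| |]; [|by []|].
  have r0 : 0 <= r.
    by rewrite -lee_fin -E integral_ge0// => t _; rewrite lee_fin powR_ge0.
  have r1 : 0 < r + 1 by lra.
  (* This [q] makes the lower bound equal to [r + 1]. *)
  have := lb _ (divr_gt0 x1 r1).
  by rewrite E lee_fin invf_div mulrCA divff ?gt_eqF// mulr1 => ?; exfalso; lra.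
have := lb 1 ltr01.
by rewrite E leNgt ltNyr.
Qed.

End Powers.

(** * The Gamma function *)

Section GammaFunction.
Variable R : realType.
Implicit Types (z s t : R).
Local Notation mu := (@lebesgue_measure R).

Definition Gamma_integrand z t : R := t `^ (z - 1) * expR (- t).

(** Euler's integral before truncation to a real number, so that the functional
    equation can be proved first and used to establish finiteness. *)
Definition eGamma z : \bar R :=
  (\int[mu]_(t in `]0%R, +oo[) (Gamma_integrand z t)%:E)%E.

Lemma GammaE z : Gamma z = fine (eGamma z). Proof. by []. Qed.

Lemma measurable_Gamma_integrand z (D : set R) : measurable D ->
  measurable_fun D (EFin \o Gamma_integrand z).
Proof.
move=> mD; apply/measurable_EFinP; apply: measurable_funTS.
apply: measurable_funM; first exact: measurable_powR.
by apply: measurableT_comp => //; exact: measurable_oppr.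
Qed.

Lemma Gamma_integrand_ge0 z t : 0 <= Gamma_integrand z t.
Proof. by rewrite mulr_ge0 ?powR_ge0 ?expR_ge0. Qed.

Lemma eGamma_ge0 z : (0 <= eGamma z)%E.
Proof. by apply: integral_ge0 => t _; rewrite lee_fin Gamma_integrand_ge0. Qed.

Lemma eGamma_gt0 z : (0 < eGamma z)%E.
Proof.
apply: ge0_integral_gt0 => //; first exact: measurable_Gamma_integrand.
  by rewrite lebesgue_measure_itv/= ltry addye.
move=> t /=; rewrite in_itv/= andbT => t0.
by rewrite lte_fin mulr_gt0 ?powR_gt0 ?expR_gt0.
Qed.

Lemma integral_expRN_tail s :
  (\int[mu]_(t in `]s, +oo[) (expR (- t))%:E = (expR (- s))%:E)%E.
Proof.
have cexpN : continuous (fun t : R^o => expR (- t)).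
  move=> t; apply: continuous_comp; first exact: opp_continuous.
  exact: continuous_expR.
rewrite integral_itv_obnd_cbnd; last first.
  apply/measurable_EFinP/measurable_funTS.
  exact: continuous_measurable_fun.
rewrite (@ge0_continuous_FTC2y _ _ (fun t => - expR (- t)) _ 0)//.
- by rewrite EFinN oppeK add0e.
- by apply: continuous_subspaceT.
- by rewrite -oppr0; apply: cvgN; exact: cvgr_expR.
- by apply: cvgN; apply/cvg_at_right_filter; exact: cexpN.
- move=> t _; rewrite derive1E; apply: derive_val; apply: is_derive_eq.
  by rewrite mulrN1 opprK.
Qed.

(** Write [t `^ z] as the integral of [z * s `^ (z - 1)] over [s < t] and exchange
    the integrals: the inner one becomes the tail [expR (- s)] of the
    exponential. *)
Lemma eGammaD1 z : 0 < z -> eGamma (z + 1) = (z%:E * eGamma z)%E.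
Proof.
move=> z0.
pose D : set R := `]0, +oo[%classic.
have mD : measurable D by exact: measurable_itv.
have mexp : measurable_fun D (fun t => (expR (- t))%:E).
  apply/measurable_EFinP; apply: measurable_funTS.
  by apply: measurableT_comp => //; exact: measurable_oppr.
have mpow : measurable_fun D (fun s => (z * s `^ (z - 1))%:E).
  apply/measurable_EFinP; apply: measurable_funTS.
  by apply: measurable_funM => //; exact: measurable_powR.
have := ge0_integral_triangle mD mpow mexp.
rewrite (_ : (\int[mu]_(t in D) _)%E = (z%:E * eGamma z)%E); last first.
  rewrite /eGamma -ge0_integralZl//; first last.
  - by rewrite lee_fin ltW.
  - by move=> t _; rewrite lee_fin Gamma_integrand_ge0.
  - exact: measurable_Gamma_integrand.
  apply: eq_integral => t /set_mem; rewrite /D/= in_itv/= andbT => t0.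
  rewrite (_ : _ `&` _ = `]t, +oo[%classic).
    by rewrite integral_expRN_tail -!EFinM /Gamma_integrand mulrA.
  apply/seteqP; split => s; rewrite /D/= !in_itv/= !andbT; first by case.
  by move=> ts; split => //; exact: lt_trans ts.
move=> ->; last 2 first.
- by move=> s _; rewrite lee_fin mulr_ge0 ?powR_ge0// ltW.
- by move=> t _; rewrite lee_fin expR_ge0.
apply: eq_integral => t /set_mem; rewrite /D/= in_itv/= andbT => t0.
rewrite (_ : _ `&` _ = `]0, t[%classic).
  by rewrite integral_powR0// -EFinM /Gamma_integrand addrK mulrC.
apply/seteqP; split => s; rewrite /D/= !in_itv/= !andbT; first by case=> -> ->.
by move=> /andP[].
Qed.

Lemma eGamma1 : eGamma 1 = 1%E.
Proof.
rewrite /eGamma -[RHS](_ : (expR (- 0))%:E = _); last by rewrite oppr0 expR0.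
rewrite -integral_expRN_tail; apply: eq_integral => t _.
by rewrite /Gamma_integrand subrr powRr0 mul1r.
Qed.

Lemma eGamma_nat_lty n : (eGamma n.+1%:R < +oo)%E.
Proof.
elim: n => [|n IH]; first by rewrite eGamma1 ltry.
by rewrite -natr1 eGammaD1// lte_mul_pinfty// ?lee_fin.
Qed.

(** By the functional equation it suffices to bound the integral at [z + 1], where
    [t `^ z <= 1 + t `^ N] for any integer [N > z]; the two terms integrate to
    factorials. *)
Lemma eGamma_fin_num z : 0 < z -> eGamma z \is a fin_num.
Proof.
move=> z0; rewrite ge0_fin_numE ?eGamma_ge0//.
suff : (eGamma (z + 1) < +oo)%E.
  rewrite eGammaD1//; case: (eGamma z) (eGamma_gt0 z) => [r||]//.
    by move=> _ _; rewrite ltry.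
  by move=> _; rewrite mulry gtr0_sg// mul1e ltxx.
have [N zN] : exists N : nat, z < N%:R.
  by exists (Num.bound z); exact/archi_boundP/ltW.
have D1N : (eGamma 1 + eGamma N.+1%:R < +oo)%E.
  by apply: lte_add_pinfty; [rewrite eGamma1 ltry|exact: eGamma_nat_lty].
apply: le_lt_trans D1N.
rewrite -ge0_integralD//; first last.
- exact: measurable_Gamma_integrand.
- by move=> t _; rewrite lee_fin Gamma_integrand_ge0.
- exact: measurable_Gamma_integrand.
- by move=> t _; rewrite lee_fin Gamma_integrand_ge0.
apply: ge0_le_integral => //.
- by move=> t _; rewrite lee_fin Gamma_integrand_ge0.
- exact: measurable_Gamma_integrand.
- by apply: emeasurable_funD; exact: measurable_Gamma_integrand.
move=> t /=; rewrite in_itv/= andbT => t0.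
rewrite -EFinD lee_fin /Gamma_integrand -mulrDl ler_wpM2r ?expR_ge0//.
rewrite addrK subrr powRr0 -natr1 addrK.
have [t1|t1] := leP 1 t.
  by rewrite ler_wpDl//; apply: ler_powR => //; exact: ltW.
rewrite ler_wpDr ?powR_ge0// -[leRHS](powRr0 t).
by apply: ger_powR; rewrite ?t0 ltW.
Qed.

Lemma GammaD1 z : 0 < z -> Gamma (z + 1) = z * Gamma z.
Proof. by move=> z0; rewrite !GammaE eGammaD1// fineM// eGamma_fin_num. Qed.

Lemma Gamma_gt0 z : 0 < z -> 0 < Gamma z.
Proof.
by move=> z0; rewrite GammaE fine_gt0// eGamma_gt0 ltey_eq eGamma_fin_num.
Qed.

End GammaFunction.

(** * The power series of modified Bessel functions *)

Section BesselSeries.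
Variable R : realType.
Implicit Types (nu m x t : R) (k : nat).
Local Notation mu := (@lebesgue_measure R).

Lemma besselI_coef_gt0 m x k : -1 < m -> 0 < x -> 0 < besselI_coef m x k.
Proof.
move=> m1 x0; rewrite /besselI_coef divr_gt0 ?powR_gt0 ?divr_gt0//.
rewrite mulr_gt0 ?ltr0n ?fact_gt0// Gamma_gt0//.
have k0 : 0 <= k%:R :> R by [].
lra.
Qed.

Lemma besselI_coef_ge0 m x k : -1 < m -> 0 < x -> 0 <= besselI_coef m x k.
Proof. by move=> m1 x0; exact/ltW/besselI_coef_gt0. Qed.

Lemma powR_besselI_coef_gt0 nu m x k : -1 < m -> 0 < x ->
  0 < x `^ nu * besselI_coef m x k.
Proof. by move=> m1 x0; rewrite mulr_gt0 ?powR_gt0 ?besselI_coef_gt0. Qed.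

Lemma powR_besselI_coef_ge0 nu m x k : -1 < m -> 0 < x ->
  0 <= x `^ nu * besselI_coef m x k.
Proof. by move=> m1 x0; exact/ltW/powR_besselI_coef_gt0. Qed.

(** Raising the order trades a factor [x / 2] for the factor [m + k + 1] coming
    from the functional equation of Gamma. *)
Lemma besselI_coef_order m x k : -1 < m -> 0 < x ->
  x / 2 * besselI_coef m x k = (m + k%:R + 1) * besselI_coef (m + 1) x k.
Proof.
move=> m1 x0; rewrite /besselI_coef.
have k0 : 0 <= k%:R :> R by [].
have mk : 0 < m + k%:R + 1 by lra.
have -> : m + 1 + 2 * k%:R = (m + 2 * k%:R) + 1 by ring.
have -> : m + 1 + k%:R + 1 = (m + k%:R + 1) + 1 by ring.
rewrite (GammaD1 mk) powRD1 ?divr_gt0//.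
field.
by rewrite (gt_eqF mk) gt_eqF ?Gamma_gt0//= pnatr_eq0 -lt0n fact_gt0.
Qed.

(** Seen from the lower order [m], the same factor [x / 2] shifts the index: the
    arguments of Gamma agree on both sides and only the factorials differ. *)
Lemma besselI_coef_shift m x k : -1 < m -> 0 < x ->
  k.+1%:R * besselI_coef m x k.+1 = x / 2 * besselI_coef (m + 1) x k.
Proof.
move=> m1 x0; rewrite /besselI_coef.
have k0 : 0 <= k%:R :> R by [].
have mk : 0 < m + k%:R + 1 + 1 by lra.
have -> : m + 2 * k.+1%:R = (m + 1 + 2 * k%:R) + 1 by rewrite -natr1; ring.
have -> : m + k.+1%:R + 1 = m + k%:R + 1 + 1 by rewrite -natr1; ring.
have -> : m + 1 + k%:R + 1 = m + k%:R + 1 + 1 by ring.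
rewrite powRD1 ?divr_gt0//.
rewrite factS natrM; field.
by rewrite gt_eqF ?Gamma_gt0//= pnatr_eq0 -lt0n fact_gt0/= gt_eqF// ltr_pwDl.
Qed.

(** The ratio of consecutive coefficients is [(x / 2)^2 / ((k + 1) (m + k + 1))],
    at most [(x / 2)^2 / ((k + 1) (m + 1))], the ratio for an exponential series;
    this gives convergence. *)
Lemma besselI_coef_le m x k : -1 < m -> 0 < x ->
  besselI_coef m x k <=
  besselI_coef m x 0 * exp_coeff ((x / 2) ^+ 2 / (m + 1)) k.
Proof.
move=> m1 x0; have m0 : 0 < m + 1 by lra.
elim: k => [|k IH]; first by rewrite /exp_coeff/= fact0 expr0 divr1 mulr1.
have k0 : 0 <= k%:R :> R by [].
have k1 : 0 < 1 + k%:R :> R by lra.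
have mk : 0 < m + k%:R + 1 by lra.
have -> : besselI_coef m x k.+1 =
    (x / 2) ^+ 2 / (m + k%:R + 1) / k.+1%:R * besselI_coef m x k.
  have e1 := besselI_coef_order k m1 x0.
  have e2 := besselI_coef_shift k m1 x0.
  have -> : besselI_coef m x k.+1 = x / 2 * besselI_coef (m + 1) x k / k.+1%:R.
    by rewrite -e2 mulrAC mulfV ?mul1r// pnatr_eq0.
  have -> : besselI_coef (m + 1) x k =
      x / 2 * besselI_coef m x k / (m + k%:R + 1).
    by rewrite e1 mulrAC mulfV ?mul1r// gt_eqF.
  by field; rewrite (gt_eqF mk) (gt_eqF k1).
have -> : exp_coeff ((x / 2) ^+ 2 / (m + 1)) k.+1 =
    (x / 2) ^+ 2 / (m + 1) / k.+1%:R * exp_coeff ((x / 2) ^+ 2 / (m + 1)) k.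
  rewrite /exp_coeff/= exprS factS natrM; field.
  by rewrite (gt_eqF m0) (gt_eqF k1)/= !pnatr_eq0 -!lt0n fact_gt0.
rewrite [leRHS]mulrCA; apply: ler_pM => //.
- by rewrite !divr_ge0 ?sqr_ge0// ltW.
- exact: besselI_coef_ge0.
- rewrite ler_pM2r ?invr_gt0// ler_wpM2l ?sqr_ge0// lef_pV2 ?posrE//.
  by rewrite lerD2r lerDl.
Qed.

Lemma is_cvg_besselI m x : -1 < m -> 0 < x -> cvgn (series (besselI_coef m x)).
Proof.
move=> m1 x0.
have m0 : 0 <= (x / 2) ^+ 2 / (m + 1) by rewrite divr_ge0 ?sqr_ge0//; lra.
apply: (series_le_cvg _ _ (fun k => besselI_coef_le k m1 x0)).
- by move=> k; exact: besselI_coef_ge0.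
- by move=> k; rewrite mulr_ge0 ?besselI_coef_ge0//= exp_coeff_ge0.
- exact/is_cvg_seriesZ/is_cvg_series_exp_coeff.
Qed.

Lemma besselI_eseries m x : -1 < m -> 0 < x ->
  (besselI m x)%:E = (\sum_(k <oo) (besselI_coef m x k)%:E)%E.
Proof.
move=> m1 x0; rewrite /besselI -EFin_lim; last exact: is_cvg_besselI.
by congr (limn _); apply/funext => n; rewrite /= /series/= sumEFin.
Qed.

Lemma powR_besselI_eseries nu m x : -1 < m -> 0 < x ->
  (x `^ nu * besselI m x)%:E =
  (\sum_(k <oo) (x `^ nu * besselI_coef m x k)%:E)%E.
Proof.
move=> m1 x0; rewrite EFinM besselI_eseries// -nneseriesZl//.
by move=> k _; rewrite lee_fin besselI_coef_ge0.
Qed.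

Lemma powR_besselI_coef nu m x k : 0 < x ->
  x `^ nu * besselI_coef m x k = besselI_coef m 1 k * x `^ (nu + m + 2 * k%:R).
Proof.
move=> x0; rewrite /besselI_coef powRM ?ltW// powRM//.
have -> : x `^ (nu + m + 2 * k%:R) = x `^ nu * x `^ (m + 2 * k%:R).
  by rewrite -addrA [LHS]powRD ?(gt_eqF x0) ?implybT.
by rewrite powR1; ring.
Qed.

Lemma besselI_ge0 m x : -1 < m -> 0 < x -> 0 <= besselI m x.
Proof.
move=> m1 x0; rewrite -lee_fin besselI_eseries// nneseries_ge0// => k _ _.
by rewrite lee_fin besselI_coef_ge0.
Qed.

Lemma measurable_powR_besselI nu m (D : set R) : -1 < m -> measurable D ->
  (forall t, D t -> 0 < t) ->
  measurable_fun D (fun t => (t `^ nu * besselI m t)%:E).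
Proof.
move=> m1 mD Dpos.
apply: (eq_measurable_fun
    (fun t => \sum_(k <oo) (t `^ nu * besselI_coef m t k)%:E)%E).
  by move=> t /set_mem /Dpos t0; rewrite powR_besselI_eseries.
apply: ge0_emeasurable_sum => [k t Dt _|k _].
  by rewrite lee_fin powR_besselI_coef_ge0// Dpos.
apply: (eq_measurable_fun
    (fun t => (besselI_coef m 1 k * t `^ (nu + m + 2 * k%:R))%:E)).
  by move=> t /set_mem /Dpos t0; rewrite powR_besselI_coef.
apply/measurable_EFinP/measurable_funTS.
by apply: measurable_funM => //; exact: measurable_powR.
Qed.

Lemma integral_powR_besselI_coef nu m x k : -1 < m -> -1 < nu + m -> 0 < x ->
  (\int[mu]_(t in `]0%R, x[) (t `^ nu * besselI_coef m t k)%:E)%E =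
  (x `^ nu * besselI_coef m x k * (x / (nu + m + 2 * k%:R + 1)))%:E.
Proof.
move=> m1 num x0; have k0 : 0 <= k%:R :> R by [].
have q0 : 0 < nu + m + 2 * k%:R + 1 by lra.
rewrite powR_besselI_coef//.
set q := nu + m + 2 * k%:R + 1 in q0 *.
set c := besselI_coef m 1 k.
have c0 : 0 <= c / q by rewrite divr_ge0 ?besselI_coef_ge0 ?ltW.
transitivity (\int[mu]_(t in `]0%R, x[) ((c / q)%:E * (q * t `^ (q - 1))%:E))%E.
  apply: eq_integral => t /set_mem/=; rewrite in_itv/= => /andP[t0 _].
  rewrite powR_besselI_coef// -EFinM /q addrK mulrA divfK ?gt_eqF//.
rewrite ge0_integralZl//; first last.
- by move=> t _; rewrite lee_fin mulr_ge0 ?powR_ge0// ltW.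
- apply/measurable_EFinP/measurable_funTS.
  by apply: measurable_funM => //; exact: measurable_powR.
rewrite integral_powR0// -EFinM; congr EFin.
rewrite {2}/q powRD1// -/c.
by field; rewrite gt_eqF.
Qed.

(** Positivity of all coefficients allows termwise integration; the condition
    [-1 < nu + m] makes the first, most singular, term integrable at 0. *)
Lemma int0_powR_besselI nu m x : -1 < m -> -1 < nu + m -> 0 < x ->
  int0 (fun t => (t `^ nu * besselI m t)%:E) x =
  (\sum_(k <oo)
     (x `^ nu * besselI_coef m x k * (x / (nu + m + 2 * k%:R + 1)))%:E)%E.
Proof.
move=> m1 num x0; rewrite /int0.
transitivity (\int[mu]_(t in `]0%R, x[)
    \sum_(k <oo) (t `^ nu * besselI_coef m t k)%:E)%E.
  apply: eq_integral => t /set_mem/=; rewrite in_itv/= => /andP[t0 _].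
  exact: powR_besselI_eseries.
rewrite integral_nneseries//.
- by apply: eq_eseriesr => k _; exact: integral_powR_besselI_coef.
- move=> k; apply: (eq_measurable_fun
      (fun t => (besselI_coef m 1 k * t `^ (nu + m + 2 * k%:R))%:E)).
    move=> t /set_mem/=; rewrite in_itv/= => /andP[t0 _].
    by rewrite powR_besselI_coef.
  apply/measurable_EFinP/measurable_funTS.
  by apply: measurable_funM => //; exact: measurable_powR.
- move=> k t /=; rewrite in_itv/= => /andP[t0 _].
  by rewrite lee_fin powR_besselI_coef_ge0.
Qed.

End BesselSeries.

(** * Inequalities obtained coefficientwise *)

Section BesselCoefficients.
Variable R : realType.
Implicit Types (nu m x t : R) (k : nat).
Local Notation mu := (@lebesgue_measure R).

Lemma besselI_coef_div m x q k : -1 < m -> 0 < x -> 0 < q ->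
  besselI_coef m x k * (x / q) =
  2 * (m + k%:R + 1) / q * besselI_coef (m + 1) x k.
Proof.
move=> m1 x0 q0; have e := besselI_coef_order k m1 x0.
have -> : 2 * (m + k%:R + 1) / q * besselI_coef (m + 1) x k =
  2 / q * ((m + k%:R + 1) * besselI_coef (m + 1) x k) by ring.
by rewrite -e; field; rewrite gt_eqF.
Qed.

(** For [nu > - 1 / 2] the two series compare termwise, with ratio
    [(2 nu + 2 k + 2) / (2 nu + 2 k + 1) > 1]. For [nu <= - 1 / 2] the first term
    of the integrand, of order [t `^ (2 nu)], already has infinite integral. *)
Lemma powR_besselI_lt_int0 nu x : -1 < nu -> 0 < x ->
  ((x `^ nu * besselI (nu + 1) x)%:E
     < int0 (fun t => (t `^ nu * besselI nu t)%:E) x)%E.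
Proof.
move=> nu1 x0; have [nu2|nu2] := leP nu (- (1 / 2)).
  suff -> : int0 (fun t => (t `^ nu * besselI nu t)%:E) x = +oo%E.
    by rewrite ltry.
  apply/eqP; rewrite eq_le leey/=.
  have c0 := besselI_coef_gt0 0 nu1 ltr01.
  have <- : ((besselI_coef nu 1 0)%:E *
      \int[mu]_(t in `]0%R, x[) (t `^ (nu + nu))%:E)%E = +oo%E.
    by rewrite integral_powR_pinfty ?gt0_muley ?lte_fin//; lra.
  rewrite -ge0_integralZl//; first last.
  - by rewrite lee_fin ltW.
  - by move=> t _; rewrite lee_fin powR_ge0.
  - exact: measurable_powR_EFin.
  apply: ge0_le_integral => //.
  - by move=> t _; rewrite -EFinM lee_fin mulr_ge0 ?powR_ge0// ltW.
  - by apply: measurable_funeM; exact: measurable_powR_EFin.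
  - apply: measurable_powR_besselI => // t /=.
    by rewrite in_itv/= => /andP[].
  move=> t /=; rewrite in_itv/= => /andP[t0 tx].
  rewrite powR_besselI_eseries// nneseries_recl//; last first.
    by move=> k _; rewrite lee_fin powR_besselI_coef_ge0.
  rewrite powR_besselI_coef// mulr0 addr0 EFinM leeDl//.
  rewrite nneseries_ge0// => k _ _.
  by rewrite lee_fin powR_besselI_coef_ge0.
have nu3 : -1 < nu + 1 by lra.
rewrite int0_powR_besselI//; last by lra.
have fin : (\sum_(k <oo) (x `^ nu * besselI_coef (nu + 1) x k)%:E < +oo)%E.
  by rewrite -powR_besselI_eseries// ltry.
rewrite powR_besselI_eseries//.
have cmp k : x `^ nu * besselI_coef (nu + 1) x k <
    x `^ nu * besselI_coef nu x k * (x / (nu + nu + 2 * k%:R + 1)).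
  have k0 : 0 <= k%:R :> R by [].
  have q0 : 0 < nu + nu + 2 * k%:R + 1 by lra.
  rewrite -mulrA ltr_pM2l ?powR_gt0// besselI_coef_div//.
  rewrite ltr_pMl ?besselI_coef_gt0// ltr_pdivlMr// mul1r.
  by lra.
apply: (@lt_nneseries _ _ _ 0%N) => // k; last exact/ltW.
by rewrite powR_besselI_coef_ge0.
Qed.

(** The ratio of the terms on the left and right of index [k] is the quotient of
    [2 (m + k + 1) / (2 nu + n + 2 k + 1)], with [m = nu + n], by its value at
    [k = 0]; it decreases in [k] because [n + 1 > 0]. So the terms of index 0
    agree and those of index 1 give strictness. *)
Lemma int0_lt_powR_besselI nu n x : - (1 / 2) < nu -> 0 <= n -> 0 < x ->
  (int0 (fun t => (t `^ nu * besselI (nu + n) t)%:E) x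
    < (2 * (nu + n + 1) / (2 * nu + n + 1)
       * (x `^ nu * besselI (nu + n + 1) x))%:E)%E.
Proof.
move=> nu2 n0 x0.
have m1 : -1 < nu + n by lra.
have m2 : -1 < nu + n + 1 by lra.
rewrite int0_powR_besselI//; last by lra.
set C := 2 * _ / _.
have C0 : 0 <= C by rewrite divr_ge0//; lra.
have bE : (C * (x `^ nu * besselI (nu + n + 1) x))%:E =
    (\sum_(k <oo) (C * (x `^ nu * besselI_coef (nu + n + 1) x k))%:E)%E.
  rewrite EFinM powR_besselI_eseries// -nneseriesZl// => k _.
  by rewrite lee_fin powR_besselI_coef_ge0.
rewrite bE.
have ratio k : C - 2 * (nu + n + k%:R + 1) / (nu + (nu + n) + 2 * k%:R + 1) =
    2 * k%:R * (n + 1) / ((2 * nu + n + 1) * (nu + (nu + n) + 2 * k%:R + 1)).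
  have k0 : 0 <= k%:R :> R by [].
  rewrite /C; field.
  by rewrite !gt_eqF//; lra.
have ratio_ge0 k : 0 <= 2 * k%:R * (n + 1)
    / ((2 * nu + n + 1) * (nu + (nu + n) + 2 * k%:R + 1)).
  have k0 : 0 <= k%:R :> R by [].
  by rewrite divr_ge0 ?mulr_ge0//; lra.
have aE k : x `^ nu * besselI_coef (nu + n) x k
      * (x / (nu + (nu + n) + 2 * k%:R + 1)) =
    2 * (nu + n + k%:R + 1) / (nu + (nu + n) + 2 * k%:R + 1) *
      (x `^ nu * besselI_coef (nu + n + 1) x k).
  have k0 : 0 <= k%:R :> R by [].
  by rewrite -mulrA besselI_coef_div 1?mulrCA//; lra.
have a0 k : 0 <= x `^ nu * besselI_coef (nu + n) x k
      * (x / (nu + (nu + n) + 2 * k%:R + 1)).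
  have k0 : 0 <= k%:R :> R by [].
  apply: mulr_ge0; first by rewrite powR_besselI_coef_ge0.
  by rewrite divr_ge0//; lra.
have ab k : x `^ nu * besselI_coef (nu + n) x k
      * (x / (nu + (nu + n) + 2 * k%:R + 1)) <=
    C * (x `^ nu * besselI_coef (nu + n + 1) x k).
  rewrite aE ler_wpM2r ?powR_besselI_coef_ge0//.
  by rewrite -subr_ge0 ratio.
apply: (@lt_nneseries _ _ _ 1%N) => //.
  rewrite aE ltr_pM2r ?powR_besselI_coef_gt0//.
  by rewrite -subr_gt0 ratio divr_gt0 ?mulr_gt0//; lra.
apply: (@le_lt_trans _ _
    (\sum_(k <oo) (C * (x `^ nu * besselI_coef (nu + n + 1) x k))%:E)%E).
  by apply: lee_nneseries => k _; rewrite lee_fin.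
by rewrite -bE ltry.
Qed.

(** The term of index [k] on the left is [2 (k + 1) / (2 nu + 2 k + 1) <= 1] times
    the term of index [k + 1] on the right, and this is where [1 / 2 <= nu]
    enters; the unmatched term of index 0 on the right gives strictness. *)
Lemma int0_lt_powR_besselIB1 nu x : 1 / 2 <= nu -> 0 < x ->
  (int0 (fun t => (t `^ nu * besselI nu t)%:E) x
    < (x `^ nu * besselI (nu - 1) x)%:E)%E.
Proof.
move=> nu2 x0.
have m1 : -1 < nu - 1 by lra.
have m2 : -1 < nu by lra.
rewrite int0_powR_besselI//; last by lra.
have b0 k : (0 <= (x `^ nu * besselI_coef (nu - 1) x k)%:E)%E.
  by rewrite lee_fin powR_besselI_coef_ge0.
have := powR_besselI_eseries nu m1 x0; rewrite nneseries_recl//.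
rewrite -(nneseries_addn 1)// => sE; rewrite sE.
apply: (@le_lt_trans _ _
    (\sum_(k <oo) (x `^ nu * besselI_coef (nu - 1) x (k + 1))%:E)%E).
  apply: lee_nneseries => k _.
    have k0 : 0 <= k%:R :> R by [].
    rewrite lee_fin => _; apply: mulr_ge0.
      by rewrite powR_besselI_coef_ge0.
    by rewrite divr_ge0//; lra.
  have k0 : 0 <= k%:R :> R by [].
  rewrite lee_fin -mulrA ler_wpM2l ?powR_ge0// addn1.
  have := besselI_coef_shift k m1 x0; rewrite subrK => e.
  have -> : besselI_coef nu x k * (x / (nu + nu + 2 * k%:R + 1)) =
     2 / (nu + nu + 2 * k%:R + 1) * (x / 2 * besselI_coef nu x k).
    by field; rewrite gt_eqF//; lra.
  rewrite -e mulrA ler_piMl ?besselI_coef_ge0//.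
  by rewrite mulrAC ler_pdivrMr ?mul1r -?natr1; lra.
rewrite lteDr ?lte_fin ?powR_besselI_coef_gt0//.
rewrite ge0_fin_numE ?nneseries_ge0//.
apply: (@le_lt_trans _ _ (x `^ nu * besselI (nu - 1) x)%:E).
  by rewrite sE leeDr.
by rewrite ltry.
Qed.

(** The rule [(x^nu I_nu)' = x^nu I_(nu-1)] in integrated form. *)
Lemma int0_powR_besselIB1 nu x : 0 < nu -> 0 < x ->
  int0 (fun t => (t `^ nu * besselI (nu - 1) t)%:E) x =
  (x `^ nu * besselI nu x)%:E.
Proof.
move=> nu0 x0.
have m1 : -1 < nu - 1 by lra.
have m2 : -1 < nu by lra.
rewrite int0_powR_besselI//; last by lra.
rewrite powR_besselI_eseries//; apply: eq_eseriesr => k _.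
have k0 : 0 <= k%:R :> R by [].
rewrite -mulrA besselI_coef_div//; last by lra.
rewrite subrK; congr (_ * _)%:E.
rewrite -[RHS]mul1r; congr (_ * _).
by field; rewrite gt_eqF//; lra.
Qed.

End BesselCoefficients.

(** * Indefinite integrals on the positive half-line *)

Section IndefiniteIntegral.
Variable R : realType.
Implicit Types (a c x t s gamma : R) (f g : R -> \bar R).
Local Notation mu := (@lebesgue_measure R).

Local Notation Rpos := (`]0%R, +oo[%classic : set R).

Lemma int0E f s : int0 f s =
  (\int[mu]_(t in `]0%R, +oo[%classic `&` [set` `]-oo, s[]) f t)%E.
Proof.
rewrite /int0; congr (integral _ _ _).
apply/seteqP; split => t /=; rewrite !in_itv/= ?andbT.
  by move=> /andP[-> ->].
by move=> [-> ->].
Qed.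

Lemma int0_ge0 f x : (forall t, 0 < t -> (0 <= f t)%E) -> (0 <= int0 f x)%E.
Proof.
move=> f0; apply: integral_ge0 => t /=; rewrite in_itv/= => /andP[t0 _].
exact: f0.
Qed.

Lemma measurable_int0 f : measurable_fun Rpos f ->
  (forall t, 0 < t -> (0 <= f t)%E) -> measurable_fun Rpos (int0 f).
Proof.
move=> mf f0; rewrite (funext (int0E f)).
apply: measurable_integral_lower => // t /=.
by rewrite in_itv/= andbT => /f0.
Qed.

Lemma measurable_fun_0oo f x : measurable_fun Rpos f ->
  measurable_fun (`]0, x[%classic : set R) f.
Proof. by apply: measurable_funS => //; exact: subset_itvl. Qed.

(** Integration by parts with a weight [h] that vanishes at [x], [g] being the
    opposite of its derivative. *)
Lemma int0_triangle f g (h : R -> R) x :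
  measurable_fun Rpos f -> measurable_fun Rpos g ->
  (forall t, 0 < t -> (0 <= f t)%E) -> (forall t, 0 < t -> (0 <= g t)%E) ->
  (forall t, 0 < t < x -> (\int[mu]_(s in `]t, x[) g s)%E = (h t)%:E) ->
  int0 (fun t => f t * (h t)%:E)%E x = int0 (fun s => g s * int0 f s)%E x.
Proof.
move=> mf mg f0 g0 hE.
have := @ge0_integral_triangle R `]0, x[%classic f g
  (measurable_itv _) (measurable_fun_0oo mf) (measurable_fun_0oo mg).
rewrite /int0 => H.
rewrite (_ : (\int[mu]_(t in `]0%R, x[) (f t * (h t)%:E))%E =
   (\int[mu]_(t in `]0%R, x[)
      (f t * \int[mu]_(s in `]0%R, x[ `&` [set` `]t, +oo[]) g s))%E).
  rewrite H.
  - apply: eq_integral => s /set_mem/=; rewrite in_itv/= => /andP[s0 sx].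
    congr (_ * integral _ _ _)%E.
    apply/seteqP; split => t /=; rewrite !in_itv/=.
      by move=> [/andP[-> _] ->].
    by move=> /andP[-> ts]; rewrite ts (lt_trans ts).
  - by move=> t /=; rewrite in_itv/= => /andP[/f0].
  - by move=> t /=; rewrite in_itv/= => /andP[/g0].
apply: eq_integral => t /set_mem/=; rewrite in_itv/= => tx.
rewrite -hE//; congr (_ * integral _ _ _)%E.
apply/seteqP; split => s /=; rewrite !in_itv/= ?andbT.
  by move=> /andP[ts ->]; rewrite ts andbT (lt_trans _ ts)//; case/andP: tx.
by move=> [/andP[_ ->] ->].
Qed.

Lemma integral_expR_itv a c t x : t < x ->
  (\int[mu]_(s in `]t, x[) (a * (c * expR (c * s)))%:E)%E =
  (a * (expR (c * x) - expR (c * t)))%:E.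
Proof.
move=> tx.
have cf b : continuous (fun s : R => b * expR (c * s)).
  move=> s; apply: cvgM; first exact: cvg_cst.
  apply: continuous_comp; last exact: continuous_expR.
  by apply: cvgM; [exact: cvg_cst|exact: cvg_id].
have mf (D : set R) : measurable_fun D (fun s => (a * (c * expR (c * s)))%:E).
  apply/measurable_EFinP; apply: measurable_funTS.
  by under eq_fun do rewrite mulrA; exact: continuous_measurable_fun.
rewrite integral_itv_bndo_bndc// integral_itv_obnd_cbnd//.
rewrite (@continuous_FTC2 _ _ (fun s => a * expR (c * s)))//.
- by rewrite -EFinB mulrBr.
- by apply: continuous_subspaceT => s; under eq_fun do rewrite mulrA; exact: cf.
- split.
  + by move=> s _; exact: ex_derive.
  + by apply/cvg_at_right_filter; exact: cf.
  + by apply/cvg_at_left_filter; exact: cf.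
- move=> s _; rewrite derive1E; apply: derive_val; apply: is_derive_eq.
  by rewrite /GRing.scale/=; ring.
Qed.

Lemma measurable_expRM c (D : set R) :
  measurable_fun D (fun s : R => expR (c * s)).
Proof. by apply: measurable_funTS; exact: measurableT_comp. Qed.

Lemma int0Zl f c x : 0 <= c -> measurable_fun Rpos f ->
  (forall t, 0 < t -> (0 <= f t)%E) ->
  (int0 (fun t => c%:E * f t) x = c%:E * int0 f x)%E.
Proof.
move=> c0 mf f0; rewrite /int0 ge0_integralZl//.
- exact: measurable_fun_0oo.
- by move=> t /=; rewrite in_itv/= => /andP[/f0].
Qed.

Lemma int0D f g x : measurable_fun Rpos f -> measurable_fun Rpos g ->
  (forall t, 0 < t < x -> (0 <= f t)%E) ->
  (forall t, 0 < t < x -> (0 <= g t)%E) ->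
  (int0 (fun t => f t + g t) x = int0 f x + int0 g x)%E.
Proof.
move=> mf mg f0 g0; rewrite /int0 ge0_integralD//.
- exact: measurable_fun_0oo.
- exact: measurable_fun_0oo.
Qed.

Lemma eq_int0 f g x : (forall t, 0 < t < x -> f t = g t) -> int0 f x = int0 g x.
Proof.
by move=> fg; apply: eq_integral => t /set_mem/=; rewrite in_itv/= => /fg.
Qed.

Lemma le_int0 f g x : measurable_fun Rpos f -> measurable_fun Rpos g ->
  (forall t, 0 < t -> (0 <= f t)%E) ->
  (forall t, 0 < t < x -> (f t <= g t)%E) -> (int0 f x <= int0 g x)%E.
Proof.
move=> mf mg f0 fg; apply: ge0_le_integral => //.
- by move=> t /=; rewrite in_itv/= => /andP[/f0].
- exact: measurable_fun_0oo.
- exact: measurable_fun_0oo.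
Qed.

Lemma lt_int0 f g x : 0 < x -> measurable_fun Rpos f -> measurable_fun Rpos g ->
  (forall t, 0 < t -> (0 <= f t)%E) ->
  (forall t, 0 < t < x -> (f t < g t)%E) ->
  (int0 f x < +oo)%E -> (int0 f x < int0 g x)%E.
Proof.
move=> x0 mf mg f0 fg fin; apply: ge0_lt_integral => //.
- by rewrite lebesgue_measure_itv/= lte_fin x0 oppr0 addr0 lte_fin.
- exact: measurable_fun_0oo.
- exact: measurable_fun_0oo.
- by move=> t /=; rewrite in_itv/= => /andP[/f0].
Qed.

(** The scalar [a] is meant to be [1] or [-1], so that [a * c] is nonnegative for
    either sign of [c]; this keeps both sides in the nonnegative setting. *)
Lemma int0_expR_triangle f a c x : 0 <= a * c ->
  measurable_fun Rpos f -> (forall t, 0 < t -> (0 <= f t)%E) ->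
  (int0 (fun t => (a * (expR (c * x) - expR (c * t)))%:E * f t) x =
   (a * c)%:E * int0 (fun s => (expR (c * s))%:E * int0 f s) x)%E.
Proof.
move=> ac0 mf f0.
have mw : measurable_fun Rpos (fun s => (expR (c * s))%:E).
  by apply/measurable_EFinP; exact: measurable_expRM.
rewrite -int0Zl//; last 2 first.
- by apply: emeasurable_funM => //; exact: measurable_int0.
- by move=> t t0; rewrite mule_ge0 ?lee_fin ?expR_ge0 ?int0_ge0.
under [RHS]eq_int0 => t _ do rewrite muleA -EFinM.
rewrite -(@int0_triangle f _ (fun t => a * (expR (c * x) - expR (c * t))))//.
- by apply: eq_int0 => t _; rewrite muleC.
- apply/measurable_EFinP; apply: measurable_funM => //.
  exact: measurable_expRM.
- by move=> t _; rewrite lee_fin mulr_ge0 ?expR_ge0.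
- move=> t /andP[_ tx].
  by rewrite -integral_expR_itv//; apply: eq_integral => s _; rewrite mulrA.
Qed.

Lemma int0_parts_expR f x :
  measurable_fun Rpos f -> (forall t, 0 < t -> (0 <= f t)%E) ->
  ((expR x)%:E * int0 f x =
   int0 (fun t => (expR t)%:E * f t) x
   + int0 (fun s => (expR s)%:E * int0 f s) x)%E.
Proof.
move=> mf f0.
have <- : (int0 (fun t => (expR x - expR t)%:E * f t) x =
    int0 (fun s => (expR s)%:E * int0 f s) x)%E.
  transitivity (int0 (fun s => (expR (1 * s))%:E * int0 f s)%E x); last first.
    by apply: eq_int0 => s _; rewrite mul1r.
  have := @int0_expR_triangle f 1 1 x; rewrite mulr1 mul1e => <- //.
  by apply: eq_int0 => t _; rewrite !mul1r.
rewrite -int0D.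
- rewrite -int0Zl ?expR_ge0//; apply: eq_int0 => t /andP[t0 tx].
  rewrite -ge0_muleDl ?lee_fin ?expR_ge0 ?subr_ge0 ?ler_expR ?(ltW tx)//.
  by rewrite -EFinD subrKC.
- apply: emeasurable_funM => //.
  by apply/measurable_EFinP; exact: measurable_funTS.
- apply: emeasurable_funM => //; apply/measurable_EFinP/measurable_funTS.
  exact: measurable_funB.
- by move=> t /andP[t0 _]; rewrite mule_ge0 ?lee_fin ?expR_ge0 ?f0.
- move=> t /andP[t0 tx]; rewrite mule_ge0 ?f0// lee_fin.
  by rewrite subr_ge0 ler_expR ltW.
Qed.

(** Integration by parts for a decreasing exponential, arranged so that no term is
    subtracted. *)
Lemma int0_parts_expRN f gamma x : 0 <= gamma ->
  measurable_fun Rpos f -> (forall t, 0 < t -> (0 <= f t)%E) ->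
  (int0 (fun t => (expR (- gamma * t))%:E * f t) x =
   (expR (- gamma * x))%:E * int0 f x
   + gamma%:E * int0 (fun s => (expR (- gamma * s))%:E * int0 f s) x)%E.
Proof.
move=> g0 mf f0.
have := @int0_expR_triangle f (-1) (- gamma) x.
rewrite mulrNN mul1r => /(_ g0 mf f0) <-.
have d0 t : t < x -> 0 <= -1 * (expR (- gamma * x) - expR (- gamma * t)).
  move=> tx; rewrite mulN1r opprB subr_ge0 ler_expR !mulNr lerN2.
  by rewrite ler_wpM2l// ltW.
rewrite -int0Zl ?expR_ge0// -int0D.
- apply: eq_int0 => t /andP[t0 tx].
  rewrite -ge0_muleDl ?lee_fin ?expR_ge0 ?d0//.
  by rewrite -EFinD; congr (_%:E * _)%E; ring.
- exact: emeasurable_funM.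
- apply: emeasurable_funM => //; apply/measurable_EFinP.
  apply: measurable_funM => //; apply: measurable_funB => //.
  exact: measurable_expRM.
- by move=> t /andP[t0 _]; rewrite mule_ge0 ?lee_fin ?expR_ge0 ?f0.
- by move=> t /andP[t0 tx]; rewrite mule_ge0 ?f0// lee_fin d0.
Qed.

End IndefiniteIntegral.

(** * Repeated integrals *)

Section RepeatedIntegrals.
Variable R : realType.
Implicit Types (nu m x t beta gamma : R) (n : nat) (F G : R -> \bar R).
Local Notation Rpos := (`]0%R, +oo[%classic : set R).

Lemma measurable_powR_besselI0 nu m : -1 < m ->
  measurable_fun Rpos (fun t => (t `^ nu * besselI m t)%:E).
Proof.
by move=> m1; apply: measurable_powR_besselI => // t /=; rewrite in_itv/= andbT.
Qed.

Lemma powR_besselI_ge0 nu m x : -1 < m -> 0 < x -> 0 <= x `^ nu * besselI m x.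
Proof. by move=> m1 x0; rewrite mulr_ge0 ?powR_ge0 ?besselI_ge0. Qed.

(** Put [P] for the integral of [F]. Since [P < G], the function
    [expR x * (F - P)], whose derivative is [expR x * (G - P)], is positive. This
    argument is run in integrated form, by comparing the two identities obtained
    from [int0_parts_expR] for [G] and for [F]. *)
Lemma int0_lt_primitive F G x : measurable_fun Rpos F -> measurable_fun Rpos G ->
  (forall t, 0 < t -> (0 <= F t)%E) -> (forall t, 0 < t -> (0 <= G t)%E) ->
  (forall t, 0 < t -> int0 G t = F t) ->
  (forall t, 0 < t -> (int0 F t < G t)%E) -> 0 < x ->
  (int0 F x < F x)%E.
Proof.
move=> mF mG F0 G0 GF FG x0.
have mP : measurable_fun Rpos (int0 F) := measurable_int0 mF F0.
have P0 t (_ : 0 < t) : (0 <= int0 F t)%E := int0_ge0 t F0.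
have mexpM (H : R -> \bar R) : measurable_fun Rpos H ->
    measurable_fun Rpos (fun t => (expR t)%:E * H t)%E.
  move=> mH; apply: emeasurable_funM => //.
  by apply/measurable_EFinP; exact: measurable_funTS.
have ge0e (H : R -> \bar R) t : (forall t, 0 < t -> (0 <= H t)%E) -> 0 < t ->
    (0 <= (expR t)%:E * H t)%E.
  by move=> H0 t0; rewrite mule_ge0 ?H0// lee_fin expR_ge0.
have ge0i (H : R -> \bar R) : (forall t, 0 < t -> (0 <= H t)%E) ->
    (0 <= int0 (fun t => (expR t)%:E * H t) x)%E.
  by move=> H0; apply: int0_ge0 => t; exact: ge0e.
have Pfin : ((expR x)%:E * int0 F x < +oo)%E.
  by rewrite lte_mul_pinfty ?lee_fin ?expR_ge0// (lt_le_trans (FG _ x0))// leey.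
rewrite -(lte_pmul2l (z := (expR x)%:E)) ?lte_fin ?expR_gt0//.
have -> : ((expR x)%:E * F x = int0 (fun t => (expR t)%:E * G t) x
    + int0 (fun t => (expR t)%:E * F t) x)%E.
  rewrite -(GF x x0) (int0_parts_expR x mG G0); congr (_ + _)%E.
  by apply: eq_int0 => t /andP[t0 _]; rewrite GF.
move: Pfin; rewrite (int0_parts_expR x mF F0) => Pfin.
rewrite addeC lteD2rE; last first.
  rewrite ge0_fin_numE; last exact: ge0i.
  by apply: le_lt_trans Pfin; rewrite leeDl//; exact: ge0i.
apply: lt_int0 => //.
- exact: mexpM.
- exact: mexpM.
- by move=> t; exact: ge0e.
- move=> t /andP[t0 _].
  by rewrite lte_pmul2l ?lte_fin ?expR_gt0//; exact: FG.
- by apply: le_lt_trans Pfin; rewrite leeDr//; exact: ge0i.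
Qed.

Lemma int0_lt_powR_besselI_same nu x : 1 / 2 <= nu -> 0 < x ->
  (int0 (fun t => (t `^ nu * besselI nu t)%:E) x
    < (x `^ nu * besselI nu x)%:E)%E.
Proof.
move=> nu2 x0.
have m1 : -1 < nu - 1 by lra.
have m2 : -1 < nu by lra.
have nu0 : 0 < nu by lra.
apply: (@int0_lt_primitive (fun t => (t `^ nu * besselI nu t)%:E)
  (fun t => (t `^ nu * besselI (nu - 1) t)%:E) x (measurable_powR_besselI0 nu m2)
  (measurable_powR_besselI0 nu m1) _ _ _ _ x0) => t t0.
- by rewrite lee_fin powR_besselI_ge0.
- by rewrite lee_fin powR_besselI_ge0.
- exact: int0_powR_besselIB1.
- exact: int0_lt_powR_besselIB1.
Qed.

Lemma repeatedI_ge0 nu beta n x : -1 < nu -> 0 < x ->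
  (0 <= repeatedI nu beta n x)%E.
Proof.
move=> nu1; elim: n x => [|n IH] x x0 /=; last exact: int0_ge0.
by rewrite lee_fin -mulrA mulr_ge0 ?expR_ge0 ?powR_besselI_ge0.
Qed.

Lemma measurable_repeatedI nu beta n : -1 < nu ->
  measurable_fun Rpos (repeatedI nu beta n).
Proof.
move=> nu1; elim: n => [|n IH] /=; last first.
  by apply: measurable_int0 => // t; exact: repeatedI_ge0.
rewrite (_ : (fun x => _) =
    (fun x => (expR (beta * x))%:E * (x `^ nu * besselI nu x)%:E)%E).
  apply: emeasurable_funM; last exact: measurable_powR_besselI0.
  by apply/measurable_EFinP; exact: measurable_expRM.
by apply/funext => x; rewrite -EFinM mulrA.
Qed.

Lemma repeatedI0 nu x : repeatedI nu 0 0 x = (x `^ nu * besselI nu x)%:E.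
Proof. by rewrite /= mul0r expR0 mul1r. Qed.

Definition repeatedI_factor nu n : R :=
  \prod_(1 <= k < n.+1) ((2 * nu + 2 * k%:R) / (2 * nu + k%:R)).

Lemma repeatedI_factorS nu n : repeatedI_factor nu n.+1 =
  repeatedI_factor nu n * (2 * (nu + n%:R + 1) / (2 * nu + n%:R + 1)).
Proof.
rewrite /repeatedI_factor big_nat_recr//=; congr (_ * (_ / _)).
  by rewrite -natr1; ring.
by rewrite -natr1; ring.
Qed.

Lemma repeatedI_factor_gt0 nu n : 0 <= nu -> 0 < repeatedI_factor nu n.
Proof.
move=> nu0; elim: n => [|n IH]; first by rewrite /repeatedI_factor big_geq.
have n0 : 0 <= n%:R :> R by [].
by rewrite repeatedI_factorS mulr_gt0// divr_gt0//; lra.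
Qed.

(** Integrating the bound for [n] leaves the integral of [t^nu I_(nu+n)], which
    [int0_lt_powR_besselI] bounds with exactly the next factor of the product. *)
Lemma repeatedI_lt_step nu n x : 0 <= nu -> 0 < x ->
  (forall t, 0 < t -> (repeatedI nu 0 n t <=
     (repeatedI_factor nu n * (t `^ nu * besselI (nu + n%:R) t))%:E)%E) ->
  (repeatedI nu 0 n.+1 x <
     (repeatedI_factor nu n.+1 * (x `^ nu * besselI (nu + n.+1%:R) x))%:E)%E.
Proof.
move=> nu0 x0 IH.
have n0 : 0 <= n%:R :> R by [].
have m1 : -1 < nu + n%:R by lra.
have c0 := repeatedI_factor_gt0 n nu0.
have nuN : - (1 / 2) < nu by lra.
apply: le_lt_trans (_ : (repeatedI_factor nu n)%:E *
    int0 (fun t => (t `^ nu * besselI (nu + n%:R) t)%:E) x < _)%E.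
  rewrite -int0Zl ?(ltW c0)//; last 2 first.
  - exact: measurable_powR_besselI0.
  - by move=> t t0; rewrite lee_fin powR_besselI_ge0.
  apply: le_int0.
  - by apply: measurable_repeatedI; lra.
  - by apply: measurable_funeM; exact: measurable_powR_besselI0.
  - by move=> t t0; apply: repeatedI_ge0 => //; lra.
  - by move=> t /andP[t0 _]; rewrite -EFinM IH.
rewrite repeatedI_factorS -mulrA EFinM lte_pmul2l ?lte_fin//.
have -> : nu + n.+1%:R = nu + n%:R + 1 by rewrite -natr1 addrA.
exact: int0_lt_powR_besselI.
Qed.

Lemma repeatedI_le nu n x : 0 <= nu -> 0 < x ->
  (repeatedI nu 0 n x <=
     (repeatedI_factor nu n * (x `^ nu * besselI (nu + n%:R) x))%:E)%E.
Proof.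
move=> nu0; elim: n x => [|n IH] x x0.
  by rewrite repeatedI0 /repeatedI_factor big_geq// mul1r addr0.
by apply/ltW/repeatedI_lt_step.
Qed.

Lemma repeatedI_lt nu n x : 0 <= nu -> 0 < x -> (1 <= n)%N ->
  (repeatedI nu 0 n x <
     (repeatedI_factor nu n * (x `^ nu * besselI (nu + n%:R) x))%:E)%E.
Proof.
move=> nu0 x0; case: n => // n _; apply: repeatedI_lt_step => // t t0.
exact: repeatedI_le.
Qed.

Lemma repeatedI_lty nu n x : 0 <= nu -> 0 < x -> (repeatedI nu 0 n x < +oo)%E.
Proof.
by move=> nu0 x0; apply: le_lt_trans (repeatedI_le n nu0 x0) _; rewrite ltry.
Qed.

Lemma repeatedI_decr nu n x : 1 / 2 <= nu -> 0 < x ->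
  (repeatedI nu 0 n.+1 x < repeatedI nu 0 n x)%E.
Proof.
move=> nu2; have nu0 : 0 <= nu by lra.
have nu1 : -1 < nu by lra.
elim: n x => [|n IH] x x0.
  rewrite repeatedI0.
  rewrite [ltLHS](eq_int0 (fun t _ => repeatedI0 nu t)).
  exact: int0_lt_powR_besselI_same.
apply: (@lt_int0 _ (repeatedI nu 0 n.+1) (repeatedI nu 0 n) x x0
  (@measurable_repeatedI nu 0 n.+1 nu1) (@measurable_repeatedI nu 0 n nu1)).
- by move=> t t0; exact: (@repeatedI_ge0 nu 0 n.+1 t nu1 t0).
- by move=> t /andP[t0 _]; exact: IH.
- exact: (@repeatedI_lty nu n.+2 x nu0 x0).
Qed.

(** Write [A k] for the integral of [expR (- gamma t) * P k t], [P k] being the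
    k-th repeated integral. Integration by parts gives
    [A n = expR (- gamma x) * P (n + 1) x + gamma * A (n + 1)], and
    [A (n + 1) <= A n] because the repeated integrals decrease with [n]; solve
    for [A n]. *)
Lemma int0_expRN_repeatedI nu gamma n x : 0 <= gamma -> gamma < 1 ->
  1 / 2 <= nu -> 0 < x ->
  (int0 (fun t => (expR (- gamma * t))%:E * repeatedI nu 0 n t) x <=
   (1 / (1 - gamma) * expR (- gamma * x))%:E * repeatedI nu 0 n.+1 x)%E.
Proof.
move=> g0 g1 nu2 x0; have nu0 : 0 <= nu by lra.
have nu1 : -1 < nu by lra.
pose P k := repeatedI nu 0 k.
have mP k : measurable_fun Rpos (P k) by exact: measurable_repeatedI.
have P0 k t : 0 < t -> (0 <= P k t)%E by exact: repeatedI_ge0.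
pose A k := int0 (fun t => (expR (- gamma * t))%:E * P k t)%E x.
have mA k : measurable_fun Rpos (fun t => (expR (- gamma * t))%:E * P k t)%E.
  apply: emeasurable_funM => //.
  by apply/measurable_EFinP; exact: measurable_expRM.
have eP0 k t : 0 < t -> (0 <= (expR (- gamma * t))%:E * P k t)%E.
  by move=> t0; rewrite mule_ge0 ?P0// lee_fin expR_ge0.
have A0 k : (0 <= A k)%E by apply: int0_ge0 => t t0; exact: eP0.
have eA : (A n = (expR (- gamma * x))%:E * P n.+1 x + gamma%:E * A n.+1)%E.
  by apply: int0_parts_expRN => //; exact: P0.
have A_decr : (A n.+1 <= A n)%E.
  apply: le_int0 => // [t t0|t /andP[t0 _]]; first exact: eP0.
  by rewrite lee_wpmul2l ?lee_fin ?expR_ge0// ltW// repeatedI_decr.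
have Pfin : P n.+1 x \is a fin_num by rewrite ge0_fin_numE ?P0 ?repeatedI_lty.
have Afin : A n \is a fin_num.
  rewrite ge0_fin_numE//; apply: (@le_lt_trans _ _ (P n.+1 x)).
    apply: le_int0 => // [t t0|t /andP[t0 _]]; first exact: eP0.
    rewrite -[leRHS]mul1e lee_wpmul2r ?P0// lee_fin -expR0 ler_expR.
    by rewrite mulNr oppr_le0 mulr_ge0// ltW.
  exact: repeatedI_lty.
have An1fin : A n.+1 \is a fin_num.
  by rewrite ge0_fin_numE//; apply: le_lt_trans A_decr _; rewrite ltey_eq Afin.
change (A n <= (1 / (1 - gamma) * expR (- gamma * x))%:E * P n.+1 x)%E.
move: A_decr eA; rewrite -(fineK Afin) -(fineK An1fin) -(fineK Pfin).
rewrite -!EFinM -EFinD !lee_fin => le [eA].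
rewrite div1r -mulrA [leRHS]mulrC ler_pdivlMr ?subr_gt0//.
by rewrite mulrBr mulr1 lerBlDr {1}eA lerD2l [leRHS]mulrC ler_wpM2l.
Qed.

Lemma repeatedI_expRN_le nu gamma n x : 0 <= gamma -> gamma < 1 ->
  1 / 2 <= nu -> 0 < x ->
  (repeatedI nu (- gamma) n x
     <= (1 / (1 - gamma) ^+ n * expR (- gamma * x))%:E * repeatedI nu 0 n x)%E.
Proof.
move=> g0 g1 nu2; have nu1 : -1 < nu by lra.
have g1' : 0 < 1 - gamma by rewrite subr_gt0.
elim: n x => [|n IH] x x0.
  by rewrite repeatedI0 expr0 divr1 mul1r -EFinM /= mulrA.
have c0 : 0 <= 1 / (1 - gamma) ^+ n by rewrite divr_ge0 ?exprn_ge0 ?ltW.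
have mE : measurable_fun Rpos
    (fun t => (expR (- gamma * t))%:E * repeatedI nu 0 n t)%E.
  apply: emeasurable_funM; last exact: measurable_repeatedI.
  by apply/measurable_EFinP; exact: measurable_expRM.
apply: (@le_trans _ _ ((1 / (1 - gamma) ^+ n)%:E *
    int0 (fun t => (expR (- gamma * t))%:E * repeatedI nu 0 n t) x)%E).
  rewrite -int0Zl//; last first.
    by move=> t t0; rewrite mule_ge0 ?repeatedI_ge0// lee_fin expR_ge0.
  apply: le_int0.
  - exact: measurable_repeatedI.
  - exact: measurable_funeM.
  - by move=> t t0; exact: repeatedI_ge0.
  - by move=> t /andP[t0 _]; rewrite muleA -EFinM IH.
apply: (le_trans (lee_wpmul2l _ (int0_expRN_repeatedI n g0 g1 nu2 x0))).
  by rewrite lee_fin.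
rewrite muleA -EFinM exprS invfM.
by rewrite le_eqVlt; apply/orP; left; apply/eqP; congr (_%:E * _)%E; ring.
Qed.

End RepeatedIntegrals.

(** * The inequalities *)

Unset Implicit Arguments.

Theorem theorem2p1 (R : realType) (gamma : R)
    (gamma_ge0 : 0 <= gamma) (gamma_lt1 : gamma < 1) (x : R) (x_gt0 : 0 < x) :
  (forall nu : R, -1 < nu ->
     ((x `^ nu * besselI (nu + 1) x)%:E
        < int0 (fun t => (t `^ nu * besselI nu t)%:E) x)%E)
  /\
  (forall nu : R, 1 / 2 <= nu ->
     (int0 (fun t => (t `^ nu * besselI nu t)%:E) x
        < (x `^ nu * besselI nu x)%:E)%E)
  /\
  (forall (nu : R) (n : nat), 1 / 2 <= nu ->
     (repeatedI nu 0%R n.+1 x < repeatedI nu 0%R n x)%E)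
  /\
  (forall (nu : R) (n : nat), 1 / 2 <= nu ->
     (repeatedI nu (- gamma)%R n x
        <= (1 / (1 - gamma) ^+ n * expR (- gamma * x))%:E
           * repeatedI nu 0%R n x)%E)
  /\
  (forall nu n : R, - (1 / 2) < nu -> 0 <= n ->
     (int0 (fun t => (t `^ nu * besselI (nu + n) t)%:E) x
        < (2 * (nu + n + 1) / (2 * nu + n + 1)
           * (x `^ nu * besselI (nu + n + 1) x))%:E)%E)
  /\
  (forall (nu : R) (n : nat), 0 <= nu -> (1 <= n)%N ->
     (repeatedI nu 0%R n x
        < ((\prod_(1 <= k < n.+1) ((2 * nu + 2 * k%:R) / (2 * nu + k%:R)))
           * (x `^ nu * besselI (nu + n%:R) x))%:E)%E)
  /\
  (forall (nu : R) (n : nat), 1 / 2 <= nu -> (1 <= n)%N ->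
     (repeatedI nu (- gamma)%R n x
        < (1 / (1 - gamma) ^+ n
           * (\prod_(1 <= k < n.+1) ((2 * nu + 2 * k%:R) / (2 * nu + k%:R)))
           * (expR (- gamma * x) * x `^ nu * besselI (nu + n%:R) x))%:E)%E).
Proof.
split; first by move=> nu nu1; exact: powR_besselI_lt_int0.
split; first by move=> nu nu2; exact: int0_lt_powR_besselI_same.
split; first by move=> nu n nu2; exact: repeatedI_decr.
split; first by move=> nu n nu2; exact: repeatedI_expRN_le.
split; first by move=> nu n nu2 n0; exact: int0_lt_powR_besselI.
split; first by move=> nu n nu0 n1; exact: repeatedI_lt.
move=> nu n nu2 n1.
have nu0 : 0 <= nu by lra.
have c0 : 0 < 1 / (1 - gamma) ^+ n * expR (- gamma * x).
  by rewrite mulr_gt0 ?expR_gt0// divr_gt0 ?exprn_gt0 ?subr_gt0.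
apply: (le_lt_trans (repeatedI_expRN_le n gamma_ge0 gamma_lt1 nu2 x_gt0)).
have := repeatedI_lt nu0 x_gt0 n1.
rewrite -(lte_pmul2l (z := (1 / (1 - gamma) ^+ n * expR (- gamma * x))%:E))//.
move=> /lt_le_trans; apply; rewrite -EFinM lee_fin /repeatedI_factor.
by rewrite le_eqVlt; apply/orP; left; apply/eqP; ring.
Qed.
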